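(* Let $M\ge 1$ and let $\mathbf m$ be a kernel concentrated at $M$, i.e. $m_n=0$ for every $n\notin\{1,M\}$. Then, for all $z\in\mathbb R$, $$\widehat Q_{\mathbf m}f(z)=(P^M f)^{**}(z).$$
   Context: Standing assumptions: $\mathbf m=(m_n)_{n\ge1}$ is a sequence with $m_n\ge0$ for all $n$ and $m_n=o(n^{-\beta})$ as $n\to\infty$ for some $\beta>3$. The function $f:\mathbb R\to[0,+\infty)$ satisfies, for some $c>0$ and all $z$, $0\le f(z)\le c(z^2+1)$ and $\frac1c z^2\le f(z)+m_1z^2$. For $k\in\mathbb N$, $z\in\mathbb R$, $\mathcal A(k;z)$ is the set of $u:\{0,\dots,k\}\to\mathbb R$ with $u_0=0$, $u_k=kz$. Define $$\widehat Q_{\mathbf m}f(z)=\lim_{k\to+\infty}\frac1k\inf\Big\{\sum_{i=1}^kf(u_i-u_{i-1})+\sum_{i,j=0}^km_{|i-j|}(u_i-u_j)^2:\ u\in\mathcal A(k;z)\Big\}$$ (terms with $i=j$ vanish; the limit exists whenever $m_n\ge0$ for all $n$, $m_n=o(n^{-\beta})$ for some $\beta>3$, and $f$ satisfies $0\le f(z)\le c(z^2+1)$ and $\frac1c z^2\le f(z)+m_1z^2$ for some $c>0$ and all $z$). For $\lambda\ge0$, $f_\lambda(z)=f(z)+\lambda z^2$. For an integer $M\ge2$, $$P^Mf(z)=\frac1M\min\Big\{\sum_{j=1}^Mf_{2m_1}(z_j):\ \sum_{j=1}^Mz_j=Mz\Big\}+2m_MM^2z^2,$$ where the minimum is understood as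 an infimum, and $P^1f(z)=f_{2m_1}(z)$. $g^{**}$ denotes the convex envelope of $g$ (the largest convex function not larger than $g$). *)

(* Defs.v *)
From HB Require Import structures.
From mathcomp Require Import all_boot all_order all_algebra.
From mathcomp Require Import all_classical all_reals all_analysis.

Set Implicit Arguments.
Unset Strict Implicit.
Unset Printing Implicit Defensive.

Import Order.TTheory GRing.Theory Num.Theory.
Import numFieldNormedType.Exports.

Local Open Scope classical_set_scope.
Local Open Scope ring_scope.

(* A kernel is a sequence m : nat -> R of which only the values m n, n >= 1,
   are meaningful: m 0 only ever multiplies terms equal to 0. *)

(* The competitors u : {0, ..., k} -> R with u_0 = 0 and u_k = k z. *)
Definition admissible (R : realType) (k : nat) (z : R) : set ('I_k.+1 -> R) :=
  [set u | u ord0 = 0 /\ u ord_max = k%:R * z].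

(* In the first sum, for i : 'I_k, lift ord0 i is i + 1 and
   widen_ord (leqnSn k) i is i, so that it is the sum over 1 <= i <= k of
   f (u_i - u_{i-1}). *)
Definition energy (R : realType) (m : nat -> R) (f : R -> R) (k : nat)
    (u : 'I_k.+1 -> R) : R :=
  \sum_(i < k) f (u (lift ord0 i) - u (widen_ord (leqnSn k) i)) +
  \sum_(i < k.+1) \sum_(j < k.+1) m `|i - j|%N * (u i - u j) ^+ 2.

Definition Qseq (R : realType) (m : nat -> R) (f : R -> R) (z : R)
    (k : nat) : R :=
  k%:R^-1 * inf [set energy m f u | u in @admissible R k z].

Definition Qhat (R : realType) (m : nat -> R) (f : R -> R) (z : R) : R :=
  limn (Qseq m f z).

Definition add_quad (R : realType) (f : R -> R) (lambda : R) (z : R) : R :=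
  f z + lambda * z ^+ 2.

Definition PM (R : realType) (M : nat) (m : nat -> R) (f : R -> R)
    (z : R) : R :=
  if M == 1%N then add_quad f (2 * m 1%N) z
  else M%:R^-1 *
         inf [set \sum_(j < M) add_quad f (2 * m 1%N) (w j)
               | w in [set w : 'I_M -> R | \sum_(j < M) w j = M%:R * z]]
       + 2 * m M * M%:R ^+ 2 * z ^+ 2.

Definition is_convex (R : realType) (h : R -> R) : Prop :=
  @convex_function R R^o setT h.

(* The pointwise supremum is the largest convex minorant as soon as there is a
   convex minorant, see convex_envP. *)
Definition convex_env (R : realType) (g : R -> R) (z : R) : R :=
  sup [set h z | h in [set h : R -> R | is_convex h /\ forall x, h x <= g x]].

Lemma convex_envP (R : realType) (g h0 : R -> R) :
  is_convex h0 -> (forall x, h0 x <= g x) ->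
  [/\ is_convex (convex_env g),
      forall x, convex_env g x <= g x &
      forall h : R -> R, is_convex h -> (forall x, h x <= g x) ->
        forall x, h x <= convex_env g x].
Proof.
move=> h0c h0g.
have ne x : [set h x | h in [set h : R -> R |
    is_convex h /\ forall x, h x <= g x]] !=set0 by exists (h0 x), h0.
have ub x : ubound [set h x | h in [set h : R -> R |
    is_convex h /\ forall x, h x <= g x]] (g x) by move=> _ [h [_ hg] <-].
have le_env (h : R -> R) : is_convex h -> (forall x, h x <= g x) ->
    forall x, h x <= convex_env g x.
  by move=> hc hg x; apply: ub_le_sup; [exists (g x)|exists h].
split=> //; last by move=> x; exact: ge_sup.
move=> t x y _ _; apply: ge_sup => // _ [h [hc hg] <-].
have := hc t x y; rewrite !inE => /(_ I I) /le_trans; apply.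
rewrite !convRE; apply: lerD; apply: ler_wpM2l.
- exact: ge0.
- exact: (le_env h hc hg x).
- by rewrite subr_ge0 le1.
- exact: (le_env h hc hg y).
Qed.

(* Main.v *)
Require Import Defs.
From mathcomp Require Import all_boot all_order all_algebra.
From mathcomp Require Import all_classical all_reals all_analysis.
From mathcomp Require Import ring lra zify.
Import Order.TTheory GRing.Theory Num.Theory.
Import numFieldNormedType.Exports.
Local Open Scope classical_set_scope.
Local Open Scope ring_scope.

(** Only the increments d_i = u_i - u_{i-1} matter. For a kernel concentrated
    at M the energy of a word d of length k is
      sum_i F(d_i) + 2 mu sum_windows (d_{i+1} + ... + d_{i+M})^2,
    where F = f + 2 m_1 z^2, the windows are the runs of M consecutive letters
    of d, and mu = m_M (or 0 when M = 1, as m_1 is then already in F). The cell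
    function P^M f(z) is the least cost of one window of mean z, when F is
    averaged over the window; its convex envelope then appears as follows.

    Lower bound ([chain_energy_ge]). Let a + b x be an affine minorant of P^M f.
    Distributing each F(d_i) evenly over the M windows that contain d_i, every
    window costs at least a + b (mean of the window), and these means add up to
    the sum k z of the letters, except that the M - 1 letters at each end lie in
    fewer than M windows. Those letters keep the unused part of F(d_i), and
    F(x) - b x >= - c b^2 / 4 by coercivity. So the energy is at least
    k (a + b z) - C with C independent of d, however large the letters near the
    ends are. With a supporting line of the envelope at z
    ([convex_supporting_line]) this reads k (P^M f)**(z) - C.

    Upper bound. Call a pair (z, v) attainable if there are words of every
    length k, with uniformly bounded letters, with sum k z up to O(1) and energy
    at most k v + O(1). Repeating periodically a competitor in the definition of
    P^M f(z) attains its cost ([attainable_mean]). Concatenating two words with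
    bounded letters creates only O(1) of energy at the junction, so
    attainability is stable under convex combinations of pairs
    ([attainable_conv]). Hence the infimum of the v attainable at z is a convex
    function of z below P^M f, and so below its envelope
    ([attainable_convex_env]). One more letter corrects the sum of an attaining
    word to exactly k z ([attainable_chain_energy]), which bounds the minimal
    energy by k v + O(1).

    Dividing both bounds by k gives the limit. *)

(** * The energy in terms of increments *)

Definition window {R : realType} (M : nat) (d : nat -> R) (i : nat) : R :=
  \sum_(j < M) d (i + j)%N.

Definition chain_energy {R : realType} (F : R -> R) (mu : R) (M k : nat)
    (d : nat -> R) : R :=
  \sum_(i < k) F (d i) + 2 * mu * \sum_(i < k.+1 - M) window M d i ^+ 2.

(** This is P^M f for F = f + 2 m_1 z^2 and mu = m_M; taking mu = 0 covers M = 1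
    with the same formula. *)
Definition cell_value {R : realType} (F : R -> R) (mu : R) (M : nat)
    (z : R) : R :=
  M%:R^-1 * inf [set \sum_(j < M) F (w j)
                  | w in [set w : 'I_M -> R | \sum_(j < M) w j = M%:R * z]]
  + 2 * mu * M%:R ^+ 2 * z ^+ 2.

Lemma sum_ord_dirac {R : realType} (K n : nat) (x : nat -> R) : (0 < n)%N ->
  \sum_(i < K) (`|(i : nat) - K|%N == n)%:R * x i =
  if (n <= K)%N then x (K - n)%N else 0.
Proof.
move=> n0; case: ifPn => nK.
  have lt : (K - n < K)%N by lia.
  rewrite (bigD1 (Ordinal lt)) //= big1 ?addr0.
    have -> : (`|(K - n)%N - K|%N == n) = true by lia.
    by rewrite mul1r.
  move=> i /eqP ne; have : (i : nat) != (K - n)%N.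
    by apply/eqP => e; apply: ne; apply: val_inj.
  move=> h; have -> : (`|(i : nat) - K|%N == n) = false.
    by have := ltn_ord i; lia.
  by rewrite mul0r.
apply: big1 => i _.
have -> : (`|(i : nat) - K|%N == n) = false by have := ltn_ord i; lia.
by rewrite mul0r.
Qed.

(** In the double sum every pair at distance n is counted twice, which is where
    the factor 2 of 2 m_1 and 2 m_M comes from. *)
Lemma sum_pairs_at_distance {R : realType} (n K : nat) (u : nat -> R) :
  (0 < n)%N ->
  \sum_(i < K) \sum_(j < K)
      (`|(i : nat) - (j : nat)|%N == n)%:R * (u i - u j) ^+ 2 =
  2 * \sum_(i < K - n) (u (i + n)%N - u i) ^+ 2.
Proof.
move=> n0; elim: K => [|K IH]; first by rewrite !big_ord0 mulr0.
rewrite big_ord_recr/=.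
under eq_bigr do rewrite big_ord_recr/=.
rewrite big_split/= IH big_ord_recr/=.
rewrite (sum_ord_dirac _ _ (fun i => (u i - u K) ^+ 2)) //.
under [X in _ + (X + _)]eq_bigr => i _ do rewrite distnC -sqrrN opprB.
rewrite (sum_ord_dirac _ _ (fun i => (u i - u K) ^+ 2)) //.
rewrite (subrr (u K)) expr0n/= mulr0 addr0.
case: ifPn => nK; last first.
  have e : (K.+1 - n = K - n)%N by clear -nK; lia.
  by rewrite e !addr0.
rewrite subSn//.
rewrite big_ord_recr/= subnK// -(sqrrN (u K - _)) opprB; ring.
Qed.

Lemma window_telescope {R : realType} (M : nat) (u : nat -> R) (i : nat) :
  window M (fun i => u i.+1 - u i) i = u (i + M)%N - u i.
Proof.
rewrite /window; elim: M => [|M IH]; first by rewrite big_ord0 addn0 subrr.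
by rewrite big_ord_recr/= IH addnS; ring.
Qed.

Lemma energy_chain {R : realType} (m : nat -> R) (f : R -> R) (M k : nat)
    (u : nat -> R) : (1 <= M)%N ->
  (forall n : nat, (0 < n)%N -> n != 1%N -> n != M -> m n = 0) ->
  energy m f (fun i : 'I_k.+1 => u i) =
  chain_energy (add_quad f (2 * m 1%N)) (if M == 1%N then 0 else m M) M k
    (fun i => u i.+1 - u i).
Proof.
move=> M1 mc; set mu := if _ then _ else _.
rewrite /energy /chain_energy /add_quad.
have -> : \sum_(i < k.+1) \sum_(j < k.+1)
      m `|i - j|%N * (u i - u j) ^+ 2 =
    m 1%N * (\sum_(i < k.+1) \sum_(j < k.+1)
      (`|(i : nat) - (j : nat)|%N == 1%N)%:R * (u i - u j) ^+ 2) +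
    mu * (\sum_(i < k.+1) \sum_(j < k.+1)
      (`|(i : nat) - (j : nat)|%N == M)%:R * (u i - u j) ^+ 2).
  rewrite !mulr_sumr -big_split; apply: eq_bigr => i _ /=.
  rewrite !mulr_sumr -big_split; apply: eq_bigr => j _ /=.
  have [-> | ij] := eqVneq i j; first by rewrite (subrr (u j)) expr0n/= !mulr0 addr0.
  rewrite 2!(mulrA _ _ (_ ^+ 2)) -mulrDl; congr (_ * _); rewrite /mu.
  have d0 : (0 < `|(i : nat) - (j : nat)|)%N.
    by rewrite lt0n distn_eq0; apply: contra_neq ij => /val_inj.
  move: d0; set n := `|_|%N => n0.
  have [->|n1] := eqVneq n 1%N.
    by case: (eqVneq M 1%N) => _ /=; rewrite ?mul0r ?mulr0 addr0 mulr1.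
  have [nM|nM] := eqVneq n M; last by rewrite mc// !mulr0 addr0.
  by rewrite -nM (negPf n1) mulr0 add0r mulr1.
rewrite !sum_pairs_at_distance// subSS subn0 big_split/= -mulr_sumr -!addrA.
congr (_ + (_ + _)); first by rewrite mulrCA mulrA; congr (_ * _);
  apply: eq_bigr => i _; rewrite addn1.
by rewrite mulrCA mulrA; congr (_ * _); apply: eq_bigr => i _;
  rewrite window_telescope.
Qed.

(** Words and admissible u determine each other: d is the sequence of increments
    of u, and u that of the partial sums of d. *)
Lemma Qseq_chain {R : realType} (m : nat -> R) (f : R -> R) (M k : nat)
    (z : R) : (1 <= M)%N ->
  (forall n : nat, (0 < n)%N -> n != 1%N -> n != M -> m n = 0) ->
  Qseq m f z k = k%:R^-1 *
    inf [set chain_energy (add_quad f (2 * m 1%N))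
               (if M == 1%N then 0 else m M) M k d
         | d in [set d : nat -> R | \sum_(i < k) d i = k%:R * z]].
Proof.
move=> M1 mc; rewrite /Qseq; congr (_ * inf _); apply/seteqP; split.
  move=> _ [u [u0 uk] <-]; pose v i := u (inord i).
  have uv : u = fun i => v (i : nat) by apply/funext => i; rewrite /v inord_val.
  exists (fun i => v i.+1 - v i); last by rewrite -(energy_chain m f M)// -uv.
  have := window_telescope k v 0; rewrite /window/= => ->.
  have -> : v (0 + k)%N = u ord_max.
    by rewrite /v; congr u; apply: val_inj; rewrite /= inordK.
  have -> : v 0%N = u ord0 by rewrite /v; congr u; apply: val_inj; rewrite /= inordK.
  by rewrite u0 uk subr0.
move=> _ [d dk <-]; pose v i := \sum_(j < i) d j.
exists (fun i => v (i : nat)); first by rewrite /admissible/= /v big_ord0.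
rewrite (energy_chain m f M)//; congr chain_energy; apply/funext => i.
by rewrite /v big_ord_recr/=; ring.
Qed.

Lemma PM_cell_value {R : realType} (m : nat -> R) (f : R -> R) (M : nat) :
  PM M m f = cell_value (add_quad f (2 * m 1%N))
    (if M == 1%N then 0 else m M) M.
Proof.
apply/funext => z; rewrite /PM /cell_value; case: eqVneq => // ->.
set E := [set _ | _ in _].
have -> : E = [set add_quad f (2 * m 1%N) z].
  apply/seteqP; split => [_ [w + <-]|_ ->].
    by rewrite /= !big_ord1 mul1r => ->.
  by exists (fun=> z); rewrite /= big_ord1 ?mul1r.
by rewrite inf1 invr1 mul1r mulr0 !mul0r addr0.
Qed.

(** * Lower bound *)

Lemma sum_shift_le {R : realType} (x : nat -> R) (N j k : nat) :
  (forall i, 0 <= x i) -> (N + j <= k)%N ->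
  \sum_(i < N) x (i + j)%N <= \sum_(i < k) x i.
Proof.
move=> x0 Nk; have -> : k = (j + (N + (k - (N + j))))%N by lia.
rewrite !big_split_ord/=; under eq_bigr do rewrite addnC.
rewrite -[leLHS]add0r lerD ?sumr_ge0// lerDl sumr_ge0// .
Qed.

Lemma cell_value_le {R : realType} (F : R -> R) (mu : R) (M : nat)
    (w : 'I_M -> R) (z : R) :
  (forall x, 0 <= F x) -> \sum_(j < M) w j = M%:R * z ->
  cell_value F mu M z <=
  M%:R^-1 * \sum_(j < M) F (w j) + 2 * mu * M%:R ^+ 2 * z ^+ 2.
Proof.
move=> F0 wz; rewrite /cell_value lerD2r ler_wpM2l// ge_inf//.
  by exists 0 => _ [v _ <-]; apply: sumr_ge0.
by exists w.
Qed.

(** The windows overlap, so each letter is shared by at most M of them. The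
    unshared part of the letters near the ends is controlled by working with
    G(x) = F(x) - b x + c b^2 / 4, which coercivity makes nonnegative: counting
    G over windows can then only lose. The number of windows is k - (M - 1),
    whence the constant. *)
Lemma chain_energy_ge {R : realType} (F : R -> R) (mu c a b : R) (M k : nat)
    (d : nat -> R) :
  0 < c -> (forall x, c^-1 * x ^+ 2 <= F x) -> (0 < M <= k)%N ->
  (forall x, a + b * x <= cell_value F mu M x) ->
  a * k%:R + b * (\sum_(i < k) d i) - M.-1%:R * (a + c * b ^+ 2 / 4) <=
  chain_energy F mu M k d.
Proof.
move=> c0 Fc /andP[M0 Mk] ab; set K := c * b ^+ 2 / 4.
pose G x := F x - b * x + K.
have F0 x : 0 <= F x.
  by apply: le_trans (Fc x); rewrite mulr_ge0 ?sqr_ge0// invr_ge0 ltW.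
have G0 x : 0 <= G x.
  (* Completing the square in x^2 / c - b x. *)
  have -> : G x = (F x - c^-1 * x ^+ 2) + c^-1 * (x - c * b / 2) ^+ 2.
    by rewrite /G /K; field; rewrite gt_eqF.
  by rewrite addr_ge0 ?subr_ge0// mulr_ge0 ?sqr_ge0// invr_ge0 ltW.
have MR0 : 0 < M%:R :> R by rewrite ltr0n.
set N := (k.+1 - M)%N.
have step i : M%:R * (a + K) <=
    \sum_(j < M) G (d (i + j)%N) + M%:R * (2 * mu * window M d i ^+ 2).
  have := cell_value_le F mu M (fun j => d (i + j)%N) (window M d i / M%:R) F0.
  rewrite mulrCA divff ?gt_eqF// mulr1 => /(_ erefl) h.
  have {h} := le_trans (ab (window M d i / M%:R)) h.
  rewrite -(ler_pM2l MR0) !mulrDr mulVKf ?gt_eqF//.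
  have -> : M%:R * (b * (window M d i / M%:R)) = b * window M d i.
    by field; rewrite gt_eqF.
  have -> : 2 * mu * M%:R ^+ 2 * (window M d i / M%:R) ^+ 2 =
      2 * mu * window M d i ^+ 2 by field; rewrite gt_eqF.
  rewrite /G !big_split/= sumrN -mulr_sumr -/(window M d i) sumr_const.
  rewrite card_ord -mulr_natl; lra.
have sumG : \sum_(i < N) \sum_(j < M) G (d (i + j)%N) <=
    M%:R * \sum_(i < k) G (d i).
  rewrite exchange_big/= mulr_natl -[M in leRHS]card_ord -sumr_const.
  apply: ler_sum => j _; apply: (sum_shift_le (fun i => G (d i))) => //.
  by have := ltn_ord j; rewrite /N; lia.
have : N%:R * (a + K) <= \sum_(i < k) G (d i) +
    2 * mu * \sum_(i < N) window M d i ^+ 2.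
  rewrite -(ler_pM2l MR0) [leRHS]mulrDr; apply: le_trans (lerD sumG (lexx _)).
  rewrite !mulr_sumr -big_split/= mulrCA.
  have -> : N%:R * (M%:R * (a + K)) = \sum_(i < N) M%:R * (a + K).
    by rewrite sumr_const card_ord mulr_natl.
  by apply: ler_sum => i _; exact: step.
rewrite /chain_energy /G !big_split/= sumrN -mulr_sumr sumr_const card_ord.
rewrite -(mulr_natl K k).
have -> : N%:R = k%:R - M.-1%:R :> R by rewrite -natrB; [congr _%:R; rewrite /N; lia|lia].
rewrite -/N; lra.
Qed.

(** * Attainable densities *)

(** The windows may start at any of the first k letters and so overhang the end
    of the word. This makes the energy exactly additive in the positions, and
    for bounded letters it changes the energy by O(1) only. *)
Definition overhang_energy {R : realType} (F : R -> R) (mu : R) (M k : nat)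
    (d : nat -> R) : R :=
  \sum_(i < k) (F (d i) + 2 * mu * window M d i ^+ 2).

(** The letters are bounded uniformly in k, so that cutting and pasting words has
    bounded cost; for this the sum of the letters is prescribed up to an error
    C only. *)
Definition attainable {R : realType} (F : R -> R) (mu : R) (M : nat)
    (z v : R) : Prop :=
  exists D C : R, forall k : nat, exists d : nat -> R,
    [/\ forall i, `|d i| <= D,
        `|\sum_(i < k) d i - k%:R * z| <= C &
        overhang_energy F mu M k d <= k%:R * v + C].

Definition cat_word {R : realType} (k : nat) (d1 d2 : nat -> R) (i : nat) : R :=
  if (i < k)%N then d1 i else d2 (i - k)%N.

Lemma normr_cat_word {R : realType} (k : nat) (d1 d2 : nat -> R) (D : R) :
  (forall i, `|d1 i| <= D) -> (forall i, `|d2 i| <= D) ->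
  forall i, `|cat_word k d1 d2 i| <= D.
Proof. by move=> D1 D2 i; rewrite /cat_word; case: ifP. Qed.

Lemma sum_cat_word {R : realType} (k1 k2 : nat) (d1 d2 : nat -> R) :
  \sum_(i < k1 + k2) cat_word k1 d1 d2 i =
  \sum_(i < k1) d1 i + \sum_(i < k2) d2 i.
Proof.
rewrite big_split_ord/=; congr (_ + _); apply: eq_bigr => i _;
  rewrite /cat_word; first by rewrite ltn_ord.
by rewrite ltnNge leq_addr/= addKn.
Qed.

Lemma sqr_window_le {R : realType} (M : nat) (d : nat -> R) (D : R) (i : nat) :
  (forall i, `|d i| <= D) -> window M d i ^+ 2 <= (M%:R * D) ^+ 2.
Proof.
move=> dD; rewrite -real_normK ?num_real// lerXn2r// ?nnegrE//.
  by rewrite mulr_ge0// (le_trans _ (dD 0%N)).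
apply: le_trans (ler_norm_sum _ _ _) _.
rewrite mulr_natl -[M in leRHS]card_ord -sumr_const.
by apply: ler_sum.
Qed.

Lemma chain_energy_le_overhang {R : realType} (F : R -> R) (mu : R)
    (M k : nat) (d : nat -> R) : 0 <= mu -> (0 < M)%N ->
  chain_energy F mu M k d <= overhang_energy F mu M k d.
Proof.
move=> mu0 M0; rewrite /chain_energy /overhang_energy big_split/= lerD2l.
rewrite -mulr_sumr ler_wpM2l ?mulr_ge0//.
have le : (k.+1 - M + 0 <= k)%N by lia.
apply: le_trans (sum_shift_le (fun i => window M d i ^+ 2) _ _ _ _ le).
  by apply: ler_sum => i _; rewrite addn0.
by move=> i; exact: sqr_ge0.
Qed.

Lemma sum_ind_geq {R : realType} (a K : nat) :
  \sum_(i < K) (a <= i)%N%:R = (K - a)%:R :> R.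
Proof.
elim: K => [|K IH]; first by rewrite big_ord0 sub0n.
by rewrite big_ord_recr/= IH -natrD; congr _%:R; case: leqP; lia.
Qed.

(** Only the windows that straddle the junction change, and there are fewer than
    M of them. *)
Lemma overhang_energy_cat {R : realType} (F : R -> R) (mu D : R)
    (M k1 k2 : nat) (d1 d2 : nat -> R) :
  0 <= mu -> (0 < M)%N ->
  (forall i, `|d1 i| <= D) -> (forall i, `|d2 i| <= D) ->
  overhang_energy F mu M (k1 + k2) (cat_word k1 d1 d2) <=
  overhang_energy F mu M k1 d1 + overhang_energy F mu M k2 d2 +
  2 * mu * (M%:R * (M%:R * D) ^+ 2).
Proof.
move=> mu0 M0 dD1 dD2; rewrite /overhang_energy big_split_ord/= addrAC.
apply: lerD; last first.
  apply: ler_sum => i _; rewrite /cat_word ltnNge leq_addr/= addKn.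
  rewrite lerD2l ler_wpM2l ?mulr_ge0// /window.
  under eq_bigr => j _ do rewrite -addnA ltnNge leq_addr/= addKn.
  by [].
set B := (M%:R * D) ^+ 2.
apply: (@le_trans _ _ (\sum_(i < k1) (F (d1 i) + 2 * mu * window M d1 i ^+ 2 +
    2 * mu * (((k1.+1 - M <= i)%N%:R) * B)))).
  apply: ler_sum => i _; rewrite {1}/cat_word ltn_ord -addrA lerD2l -mulrDr.
  rewrite ler_wpM2l ?mulr_ge0//; case: leqP => ik /=.
    rewrite mul1r -[leLHS]add0r lerD ?sqr_ge0//.
    by apply: sqr_window_le; exact: normr_cat_word.
  rewrite mul0r addr0 (_ : window _ _ _ = window M d1 i)//.
  apply: eq_bigr => j _; rewrite /cat_word ifT//.
  by have := ltn_ord j; move: ik; clear; lia.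
rewrite big_split/= lerD2l -mulr_sumr -mulr_suml sum_ind_geq.
by rewrite ler_wpM2l ?mulr_ge0// ler_wpM2r ?sqr_ge0// ler_nat; lia.
Qed.

(** Follow a word for z1 of length floor (t k) by a word for z2. Rounding t k
    costs at most |z1 - z2| in the sum and |v1 - v2| in the energy. *)
Lemma attainable_conv {R : realType} (F : R -> R) (mu : R) (M : nat)
    (t z1 z2 v1 v2 : R) :
  0 <= mu -> (0 < M)%N -> 0 <= t <= 1 ->
  attainable F mu M z1 v1 -> attainable F mu M z2 v2 ->
  attainable F mu M (t * z1 + (1 - t) * z2) (t * v1 + (1 - t) * v2).
Proof.
move=> mu0 M0 /andP[t0 t1] [D1 [C1 h1]] [D2 [C2 h2]].
pose D := Num.max D1 D2.
exists D, (C1 + C2 + `|z1 - z2| + `|v1 - v2| +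
           2 * mu * (M%:R * (M%:R * D) ^+ 2)) => k.
have kt0 : 0 <= t * k%:R by rewrite mulr_ge0.
pose k1 := Num.truncn (t * k%:R).
have /andP[k1l k1u] : k1%:R <= t * k%:R < k1.+1%:R by exact: truncn_itv.
have k1k : (k1 <= k)%N.
  by rewrite -(ler_nat R) (le_trans k1l)// ler_piMl.
have [d1 [dD1 s1 e1]] := h1 k1; have [d2 [dD2 s2 e2]] := h2 (k - k1)%N.
have {}dD1 i : `|d1 i| <= D by rewrite le_max dD1.
have {}dD2 i : `|d2 i| <= D by rewrite le_max dD2 orbT.
exists (cat_word k1 d1 d2).
have round (x1 x2 : R) : `|k1%:R * x1 + (k - k1)%:R * x2 -
    k%:R * (t * x1 + (1 - t) * x2)| <= `|x1 - x2|.
  rewrite natrB// (_ : _ - _ = (k1%:R - t * k%:R) * (x1 - x2)); last by ring.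
  rewrite normrM ler_piMl// distrC ger0_norm ?subr_ge0//.
  by rewrite lerBlDl -[1]/(1%:R) -natrD addn1 ltW.
have B0 : 0 <= 2 * mu * (M%:R * (M%:R * D) ^+ 2).
  by apply: mulr_ge0; apply: mulr_ge0 => //; exact: sqr_ge0.
split; first exact: normr_cat_word.
- have := sum_cat_word k1 (k - k1) d1 d2; rewrite subnKC// => ->.
  move: (round z1 z2) s1 s2 (normr_ge0 (v1 - v2)) B0.
  set B := 2 * mu * _; set V := `|v1 - v2|; set Z := `|z1 - z2|.
  rewrite !ler_norml; lra.
- have := overhang_energy_cat F mu D M k1 (k - k1) d1 d2 mu0 M0 dD1 dD2.
  rewrite subnKC// => /le_trans; apply.
  move: (round v1 v2) e1 e2 (normr_ge0 (z1 - z2)).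
  set B := 2 * mu * _; set V := `|v1 - v2|; set Z := `|z1 - z2|.
  rewrite ler_norml; lra.
Qed.


(** Full periods contribute nothing, so only an incomplete one remains. *)
Lemma sum_periodic_bound {R : realType} (M : nat) (x : nat -> R) (k : nat) :
  (0 < M)%N -> (forall i, x (M + i)%N = x i) -> \sum_(i < M) x i = 0 ->
  `|\sum_(i < k) x i| <= \sum_(i < M) `|x i|.
Proof.
move=> M0 xM x0; elim/ltn_ind: k => k IH; have [kM|kM] := leqP k M.
  apply: le_trans (ler_norm_sum _ _ _) _.
  have le : (k + 0 <= M)%N by rewrite addn0.
  apply: le_trans (sum_shift_le (fun i => `|x i|) _ _ _ _ le) => //.
  by apply: ler_sum => i _; rewrite addn0.
have := IH (k - M)%N; rewrite -[in \sum_(i < k) _](subnKC (ltnW kM)).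
rewrite big_split_ord/= x0 add0r.
under [in X in _ -> X]eq_bigr do rewrite xM.
by apply; lia.
Qed.

Lemma sum_periodic_mean {R : realType} (M : nat) (x : nat -> R) (k : nat) :
  (0 < M)%N -> (forall i, x (M + i)%N = x i) ->
  `|\sum_(i < k) x i - k%:R * (M%:R^-1 * \sum_(i < M) x i)| <=
  \sum_(i < M) `|x i - M%:R^-1 * \sum_(i < M) x i|.
Proof.
move=> M0 xM; set s := M%:R^-1 * _.
have sumB n : \sum_(i < n) (x i - s) = \sum_(i < n) x i - n%:R * s.
  by rewrite big_split/= sumr_const card_ord mulNrn mulr_natl.
rewrite -sumB; apply: (sum_periodic_bound _ (fun i => x i - s)) => //.
  by move=> i; rewrite xM.
by rewrite sumB /s mulVKf ?subrr// pnatr_eq0 -lt0n.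
Qed.

Lemma window_periodic {R : realType} (M : nat) (d : nat -> R) (i : nat) :
  (forall i, d (M + i)%N = d i) -> window M d i = \sum_(j < M) d j.
Proof.
move=> dM; elim: i => // i <-.
apply/(addrI (d i)); rewrite /window.
have -> : d i + \sum_(j < M) d (i.+1 + j)%N = \sum_(j < M.+1) d (i + j)%N.
  rewrite big_ord_recl/= addn0; congr (_ + _); apply: eq_bigr => j _.
  by rewrite addSnnS.
by rewrite big_ord_recr/= addrC (addnC i) dM.
Qed.

(** Repeat w periodically: every window is then a cyclic shift of w, so its sum
    is exactly M z. *)
Lemma attainable_mean {R : realType} (F : R -> R) (mu : R) (M : nat)
    (w : 'I_M -> R) (z : R) :
  (0 < M)%N -> \sum_(j < M) w j = M%:R * z ->
  attainable F mu M z
    (M%:R^-1 * \sum_(j < M) F (w j) + 2 * mu * M%:R ^+ 2 * z ^+ 2).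
Proof.
case: M w => // M w M0 wz; pose d i := w (inord (i %% M.+1)).
have dM i : d (M.+1 + i)%N = d i by rewrite /d modnDl.
have dw (j : 'I_M.+1) : d j = w j by rewrite /d modn_small// inord_val.
have sumd : \sum_(j < M.+1) d j = M.+1%:R * z.
  by rewrite -wz; apply: eq_bigr => j _; rewrite dw.
pose FM := M.+1%:R^-1 * \sum_(j < M.+1) F (d j).
exists (\sum_(j < M.+1) `|w j|), (\sum_(j < M.+1) `|d j - z| +
  \sum_(j < M.+1) `|F (d j) - FM|) => k; exists d; split.
- move=> i; rewrite /d (bigD1 (inord (i %% M.+1)))//= lerDl.
  exact: sumr_ge0.
- have := sum_periodic_mean _ _ k M0 dM.
  rewrite sumd mulKf ?pnatr_eq0// => /le_trans; apply.
  by rewrite lerDl; exact: sumr_ge0.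
- have := sum_periodic_mean _ (fun i => F (d i)) k M0.
  move=> /(_ (fun i => congr1 F (dM i))); rewrite -/FM ler_norml => /andP[_].
  have -> : \sum_(j < M.+1) F (w j) = \sum_(j < M.+1) F (d j).
    by apply: eq_bigr => j _; rewrite dw.
  rewrite -/FM /overhang_energy big_split/=.
  under [X in _ -> _ + X <= _]eq_bigr do rewrite window_periodic// sumd.
  rewrite sumr_const card_ord -(mulr_natl (_ * _) k).
  have : 0 <= \sum_(j < M.+1) `|d j - z| by exact: sumr_ge0.
  by rewrite exprMn; lra.
Qed.

(** A last letter, bounded because the sum was right up to O(1), restores the
    exact constraint. *)
Lemma attainable_chain_energy {R : realType} (F : R -> R) (mu C : R) (M : nat)
    (z v : R) :
  0 <= mu -> (0 < M)%N -> 0 <= C -> (forall x, F x <= C * (x ^+ 2 + 1)) ->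
  attainable F mu M z v ->
  exists C' : R, forall k : nat, exists2 d : nat -> R,
    \sum_(i < k.+1) d i = k.+1%:R * z &
    chain_energy F mu M k.+1 d <= k.+1%:R * v + C'.
Proof.
move=> mu0 M0 C0 FC [D [E h]].
pose D' := Num.max D (E + `|z|).
exists (E + C * (D' ^+ 2 + 1) + 2 * mu * (M%:R * D') ^+ 2 +
  2 * mu * (M%:R * (M%:R * D') ^+ 2) + `|v|) => k.
have [d [dD sd ed]] := h k.
pose x := k.+1%:R * z - \sum_(i < k) d i.
have xD : `|x| <= D'.
  rewrite le_max; apply/orP; right; rewrite distrC in sd.
  have -> : x = (k%:R * z - \sum_(i < k) d i) + z by rewrite /x -natr1; ring.
  by rewrite (le_trans (ler_normD _ _))// lerD2r.
have {}dD i : `|d i| <= D' by rewrite le_max dD.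
exists (cat_word k d (fun=> x)).
  have := sum_cat_word k 1 d (fun=> x); rewrite addn1 big_ord1 => ->.
  by rewrite /x; ring.
apply: le_trans (chain_energy_le_overhang _ _ _ _ _ mu0 M0) _.
have := overhang_energy_cat F mu D' M k 1 d (fun=> x) mu0 M0 dD (fun=> xD).
rewrite addn1 => /le_trans; apply.
have : overhang_energy F mu M 1 (fun=> x) <=
    C * (D' ^+ 2 + 1) + 2 * mu * (M%:R * D') ^+ 2.
  rewrite /overhang_energy big_ord1 lerD//.
    apply: le_trans (FC _) _; rewrite ler_wpM2l// lerD2r.
    by rewrite -real_normK ?num_real// lerXn2r// nnegrE (le_trans _ xD).
  by rewrite ler_wpM2l ?mulr_ge0//; apply: sqr_window_le.
have : - `|v| <= v by rewrite lerNl -normrN ler_norm.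
rewrite -natr1; lra.
Qed.

(** Ensures that the attainable densities at z have an infimum. *)
Lemma attainable_ge0 {R : realType} (F : R -> R) (mu : R) (M : nat)
    (z v : R) :
  0 <= mu -> (forall x, 0 <= F x) -> attainable F mu M z v -> 0 <= v.
Proof.
move=> mu0 F0 [D [C h]]; rewrite leNgt; apply/negP => v0.
have [k kC] : exists k : nat, C / - v < k%:R.
  by exists (Num.truncn (C / - v)).+1; exact: truncnS_gt.
have [d [_ _]] := h k; rewrite leNgt => /negP; apply.
apply: (@lt_le_trans _ _ 0).
  by move: kC; rewrite ltr_pdivrMr ?oppr_gt0//; lra.
apply: sumr_ge0 => i _; rewrite addr_ge0//.
by apply: mulr_ge0; [exact: mulr_ge0|exact: sqr_ge0].
Qed.

(** * Convex envelopes *)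

Lemma is_convexP {R : realType} (h : R -> R) :
  is_convex h <->
  forall t x y : R, 0 <= t <= 1 ->
    h (t * x + (1 - t) * y) <= t * h x + (1 - t) * h y.
Proof.
split=> [hc t x y t01|hc t x y _ _].
  have ht : Itv.spec (@Itv.num_sem R) (Itv.Real `[0%Z, 1%Z]) t.
    by rewrite /= /Itv.num_sem/= num_real/= in_itv/=.
  have := hc (Itv.mk ht) x y; rewrite !inE => /(_ I I).
  by rewrite !convRE.
rewrite !convRE; apply: hc; apply/andP; split; first exact: ge0.
exact: le1.
Qed.

(** The slope b is the left derivative of h at z, the supremum of the slopes of
    the chords ending at z; it is finite because each of these is at most the
    slope of any chord starting at z. *)
Lemma convex_supporting_line {R : realType} (h : R -> R) (z : R) :
  is_convex h -> exists b, forall x, h z + b * (x - z) <= h x.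
Proof.
move=> /is_convexP hc.
pose slope y := (h z - h y) / (z - y).
have slopes y x : y < z -> z < x -> slope y <= (h x - h z) / (x - z).
  move=> yz zx; have yx := lt_trans yz zx.
  have p1 : 0 < z - y by rewrite subr_gt0.
  have p2 : 0 < x - z by rewrite subr_gt0.
  have p3 : 0 < x - y by rewrite subr_gt0.
  have t01 : 0 <= (x - z) / (x - y) <= 1.
    apply/andP; split; first by apply: divr_ge0; exact: ltW.
    by rewrite ler_pdivrMr// mul1r lerB// ltW.
  have := hc _ y x t01.
  have -> : (x - z) / (x - y) * y + (1 - (x - z) / (x - y)) * x = z.
    by field; rewrite gt_eqF.
  rewrite -(ler_pM2l p3) => H.
  rewrite /slope ler_pdivrMr// mulrAC ler_pdivlMr//.
  have : (x - y) * ((x - z) / (x - y) * h y + (1 - (x - z) / (x - y)) * h x) =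
    (x - z) * h y + (z - y) * h x by field; rewrite gt_eqF.
  by move=> E; rewrite E in H; lra.
pose S := [set slope y | y in [set y | y < z]].
have S0 : S !=set0 by exists (slope (z - 1)), (z - 1) => //=; lra.
have Sub x : z < x -> ubound S ((h x - h z) / (x - z)).
  by move=> zx _ [y yz <-]; exact: slopes.
exists (sup S) => x; have [xz|zx|->] := ltgtP x z; last by lra.
- have : slope x <= sup S.
    apply: ub_le_sup; last by exists x.
    by exists ((h (z + 1) - h z) / (z + 1 - z)); apply: Sub; lra.
  by rewrite /slope ler_pdivrMr ?subr_gt0//; lra.
- have : sup S <= (h x - h z) / (x - z) by apply: ge_sup => //; exact: Sub.
  by rewrite ler_pdivlMr ?subr_gt0//; lra.
Qed.

(** The infimum of the attainable densities is convex and lies below the cell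
    function, so the envelope, the largest such function, lies above it. *)
Lemma attainable_convex_env {R : realType} (F : R -> R) (mu : R) (M : nat)
    (z e : R) :
  0 <= mu -> (0 < M)%N -> (forall x, 0 <= F x) -> 0 < e ->
  exists2 v, attainable F mu M z v &
             v <= convex_env (cell_value F mu M) z + e.
Proof.
move=> mu0 M0 F0 e0.
pose H x := inf [set v | attainable F mu M x v].
have lb x : has_lbound [set v | attainable F mu M x v].
  by exists 0 => v; exact: attainable_ge0.
have hasinf x : has_inf [set v | attainable F mu M x v].
  split=> //; eexists; apply: (attainable_mean F mu M (fun=> x)) => //.
  by rewrite sumr_const card_ord mulr_natl.
have HF x : H x <= cell_value F mu M x.
  rewrite /cell_value -lerBlDr -(ler_pM2l (_ : 0 < M%:R)) ?ltr0n//.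
  rewrite mulVKf ?pnatr_eq0 -?lt0n//; apply: lb_le_inf.
    by eexists; exists (fun=> x) => //=; rewrite sumr_const card_ord mulr_natl.
  move=> _ [w wx <-]; rewrite -(ler_pM2l (_ : 0 < M%:R^-1)) ?invr_gt0 ?ltr0n//.
  rewrite mulKf ?pnatr_eq0 -?lt0n// lerBlDr.
  by apply: ge_inf => //; exact: attainable_mean.
have Hc : is_convex H.
  apply/is_convexP => t x y t01; apply/ler_addgt0Pr => d d0.
  have [v1 a1 l1] := inf_adherent d0 (hasinf x).
  have [v2 a2 l2] := inf_adherent d0 (hasinf y).
  have : H (t * x + (1 - t) * y) <= t * v1 + (1 - t) * v2.
    by apply: ge_inf => //; exact: attainable_conv.
  move/le_trans; apply; case/andP: t01 => t0 t1.
  apply: (@le_trans _ _ (t * (H x + d) + (1 - t) * (H y + d))); last by lra.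
  by rewrite lerD// ler_wpM2l ?subr_ge0// ltW.
have [_ _ /(_ H Hc HF z) Hz] := convex_envP Hc HF.
have [v va vl] := inf_adherent e0 (hasinf z).
by exists v => //; rewrite (le_trans (ltW vl))// lerD2r.
Qed.

(** * The limit density *)

Theorem proposition2p16 (R : realType) (m : nat -> R) (beta : R)
    (f : R -> R) (c : R) (M : nat)
    (m_ge0 : forall n : nat, (0 < n)%N -> 0 <= m n)
    (beta_gt3 : 3 < beta)
    (m_decay : (m : nat -> R^o) =o_\oo (fun n : nat => n%:R `^ (- beta) : R^o))
    (c_gt0 : 0 < c)
    (f_growth : forall z : R, 0 <= f z <= c * (z ^+ 2 + 1))
    (f_coercive : forall z : R, c^-1 * z ^+ 2 <= f z + m 1%N * z ^+ 2)
    (M_ge1 : (1 <= M)%N)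
    (m_conc : forall n : nat, (0 < n)%N -> n != 1%N -> n != M -> m n = 0) :
  forall z : R,
    cvgn (Qseq m f z : nat -> R^o) /\ Qhat m f z = convex_env (PM M m f) z.
Proof.
move=> z; pose F := add_quad f (2 * m 1%N).
pose mu := if M == 1%N then 0 else m M.
have m1 : 0 <= m 1%N by exact: m_ge0.
have mu0 : 0 <= mu by rewrite /mu; case: ifP => // _; exact: m_ge0.
have F0 x : 0 <= F x.
  have /andP[f0 _] := f_growth x; rewrite addr_ge0//.
  by apply: mulr_ge0; [exact: mulr_ge0|exact: sqr_ge0].
have Fge x : c^-1 * x ^+ 2 <= F x.
  apply: le_trans (f_coercive x) _; rewrite lerD2l ler_wpM2r ?sqr_ge0//; lra.
have Fle x : F x <= (c + 2 * m 1%N) * (x ^+ 2 + 1).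
  by have /andP[_] := f_growth x; rewrite /F /add_quad; lra.
rewrite PM_cell_value -/F -/mu; set L := convex_env _ z.
pose E k := [set chain_energy F mu M k d
            | d in [set d : nat -> R | \sum_(i < k) d i = k%:R * z]].
have QE k : Qseq m f z k = k%:R^-1 * inf (E k) by exact: Qseq_chain.
have E0 k d : 0 <= chain_energy F mu M k d.
  rewrite addr_ge0 ?sumr_ge0//; apply: mulr_ge0; first exact: mulr_ge0.
  by apply: sumr_ge0 => i _; exact: sqr_ge0.
have Elb k : has_lbound (E k) by exists 0 => _ [d _ <-].
have En0 k : E k !=set0.
  by eexists; exists (fun=> z) => //=; rewrite sumr_const card_ord mulr_natl.
have cell0 x : 0 <= cell_value F mu M x.
  rewrite addr_ge0//.
    apply: mulr_ge0; rewrite ?invr_ge0//; apply: lb_le_inf.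
      by eexists; exists (fun=> x) => //=; rewrite sumr_const card_ord mulr_natl.
    by move=> _ [w _ <-]; exact: sumr_ge0.
  by apply: mulr_ge0 (sqr_ge0 _); apply: mulr_ge0 (sqr_ge0 _); exact: mulr_ge0.
have c0 : is_convex (fun=> 0 : R).
  by apply/is_convexP => t x y _; rewrite !mulr0 addr0.
have [envc env_le _] := convex_envP c0 cell0.
have [b bP] := convex_supporting_line _ z envc.
pose C1 := M.-1%:R * (L - b * z + c * b ^+ 2 / 4).
have lower k : (M <= k)%N -> L * k%:R - C1 <= inf (E k).
  move=> Mk; apply: lb_le_inf => // _ [d dz <-].
  have := @chain_energy_ge R F mu c (L - b * z) b M k d c_gt0 Fge.
  rewrite M_ge1 Mk dz => /(_ isT) /(_ _) H.
  apply: le_trans (H _); first by rewrite /C1; lra.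
  by move=> x; apply: le_trans (env_le x); have := bP x; rewrite -/L; lra.
suff : Qseq m f z k @[k --> \oo] --> (L : R^o).
  by move=> cv; split; [apply/cvg_ex; exists L|exact: cvg_lim].
apply/cvgrPdist_le => e e0.
have e20 : 0 < e / 2 by rewrite divr_gt0.
have [v va vL] := attainable_convex_env _ _ _ z _ mu0 M_ge1 F0 e20.
have [|C2 C2P] := attainable_chain_energy F mu (c + 2 * m 1%N) M z v
  mu0 M_ge1 _ Fle va; first by rewrite addr_ge0 ?mulr_ge0// ltW.
have upper k : (0 < k)%N -> inf (E k) <= k%:R * v + C2.
  case: k => // k _; have [d dz de] := C2P k.
  by apply: le_trans de; apply: ge_inf => //; exists d.
near=> k.
have k0 : (0 < k)%N by near: k; exact: nbhs_infty_gt.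
have kR0 : 0 < k%:R :> R by rewrite ltr0n.
have kM : (M <= k)%N by near: k; exact: nbhs_infty_ge.
have kC1 : C1 / e <= k%:R by near: k; exact: nbhs_infty_ger.
have kC2 : C2 / (e / 2) <= k%:R by near: k; exact: nbhs_infty_ger.
rewrite ler_pdivrMr// in kC1; rewrite ler_pdivrMr// in kC2.
have lo := lower k kM; have up := upper k k0.
have kv : k%:R * v <= k%:R * (L + e / 2) by rewrite ler_wpM2l.
rewrite QE distrC ler_norml -(ler_pM2l kR0) -[X in _ && X](ler_pM2l kR0).
by rewrite mulrBr mulVKf ?gt_eqF//; apply/andP; split; lra.
Unshelve. all: by end_near.
Qed.
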